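(* In the single-peaked domain, the time complexity of the problem CheckPO is $\Omega(n)$, where $n$ is the number of agents (and of resources). That is, every algorithm that correctly solves CheckPO on all single-peaked instances has worst-case running time $\Omega(n)$.
   Context: Setting. $\mathcal{N}=\{a_1,\dots,a_n\}$ is a set of $n$ agents and $\mathcal{R}$ a set of $n$ resources. An allocation $\pi$ assigns to each agent $a_i$ a single resource $\pi_{a_i}\in\mathcal{R}$, distinct agents getting distinct resources. Each agent $a_i$ has a strict linear order $\succ_i$ over $\mathcal{R}$; $L=\langle\succ_i\rangle_{a_i\in\mathcal{N}}$. An instance is $I=\langle\mathcal{N},\mathcal{R},L,\pi^0\rangle$ with $\pi^0$ an initial allocation. Single-peakedness. Given a linear order (axis) $\lhd$ on $\mathcal{R}$, a linear order $\succ$ on $\mathcal{R}$ with top resource $top(\succ)$ is single-peaked with respect to $\lhd$ if for all $r,r'\in\mathcal{R}$ with $r'\lhd r\lhd top(\succ)$ or $top(\succ)\lhd r\lhd r'$ one has $r\succ r'$. The instance is single-peaked with respect to $\lhd$ if all $\succ_i$ are. Pareto-optimality. $\pi$ is Pareto-optimal if there is no allocation $\pi'$ such that every agent $a_i$ has $\pi'_{a_i}\succ_i\pi_{a_i}$ or $\pi'_{a_i}=\pi_{a_i}$, and at least one agent $a_j$ has $\pi'_{a_j}\succ_j\pi_{a_j}$. CheckPO. Given an instance $I=\langle\mathcal{N},\mathcal{R},L,\pi^0\rangle$ that is single-peaked with respect to a known axis $\lhd$, answer yes if and only if $\pi^0$ is Pareto-optimal. Model. The algorithm has access to the preferences only by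 querying the agents (one agent per query) about their own preference order, and each query takes at least one unit of time. *)

(* Defs.v *)
From HB Require Import structures.
From mathcomp Require Import all_boot all_order all_algebra.
From mathcomp Require Import all_classical all_reals all_analysis.

Set Implicit Arguments.
Unset Strict Implicit.
Unset Printing Implicit Defensive.

Local Open Scope nat_scope.

(* Orders are finite functions, so that orders, profiles and instances form
   finite types and a worst case over instances is a plain maximum. *)
Definition strict_linear (R : finType) (p : {ffun R -> {ffun R -> bool}}) :=
  [&& [forall x, ~~ p x x],
      [forall x, forall y, forall z, p x y && p y z ==> p x z]
    & [forall x, forall y, (x != y) ==> p x y || p y x]].

Record linorder (R : finType) : Type := LinOrder {
  lo_fun :> {ffun R -> {ffun R -> bool}};
  _ : strict_linear lo_fun
}.
HB.instance Definition _ (R : finType) := [isSub for @lo_fun R].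
HB.instance Definition _ (R : finType) := [Finite of linorder R by <:].

Record allocation (N R : finType) : Type := Allocation {
  al_fun :> {ffun N -> R};
  _ : injectiveb al_fun
}.
HB.instance Definition _ (N R : finType) := [isSub for @al_fun N R].
HB.instance Definition _ (N R : finType) := [Finite of allocation N R by <:].

Definition profile (N R : finType) := {ffun N -> linorder R}.
HB.instance Definition _ (N R : finType) := Finite.on (profile N R).

Definition is_top (R : finType) (p : linorder R) (t : R) : bool :=
  [forall r, (r != t) ==> p t r].

(* [axis x y] reads "x is to the left of y"; [p x y] reads "x is preferred
   to y". *)
Definition single_peaked_order (R : finType) (axis p : linorder R) : bool :=
  [forall t, is_top p t ==>
    [forall r, forall r',
      (axis r' r && axis r t) || (axis t r && axis r r') ==> p r r']].

Definition single_peaked (N R : finType) (axis : linorder R)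
    (L : profile N R) : bool :=
  [forall a, single_peaked_order axis (L a)].

Definition pareto_optimal (N R : finType) (L : profile N R)
    (pi : allocation N R) : Prop :=
  ~ exists pi' : allocation N R,
      (forall a, L a (pi' a) (pi a) \/ pi' a = pi a) /\
      (exists a, L a (pi' a) (pi a)).

(* A query is addressed to a single agent and may ask for any information
   whatsoever, of any type, about that agent's own order. *)
Record query (N R : finType) : Type := Query {
  addressee : N;
  answer : Type;
  reply : linorder R -> answer
}.

(* The interaction of an algorithm with the agents: [Return b] stops with
   answer [b], [Compute p] spends one unit of time on local work, and
   [Ask q k] issues [q] and goes on according to the answer received.
   Trees are well-founded: a correct algorithm halts on every single-peaked
   profile, and its behaviour on other profiles is not constrained. *)
Inductive program (N R : finType) : Type :=
| Return of bool
| Compute of program N R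
| Ask (q : query N R) of (answer q -> program N R).

Fixpoint run (N R : finType) (p : program N R) (L : profile N R) : bool :=
  match p with
  | Return b => b
  | Compute p' => run p' L
  | Ask q k => run (k (reply q (L (addressee q)))) L
  end.

(* [d q o] is the time taken by query [q] when the order of its addressee is
   [o]. *)
Fixpoint time (N R : finType) (d : query N R -> linorder R -> nat)
    (p : program N R) (L : profile N R) : nat :=
  match p with
  | Return _ => 0
  | Compute p' => (time d p' L).+1
  | Ask q k => d q (L (addressee q)) + time d (k (reply q (L (addressee q)))) L
  end.

(* With n agents and n resources, each labelled by 'I_n; the axis (an
   arbitrary linear order on the resources) and the initial allocation are
   known in advance, whereas the profile is reachable only through queries. *)
Definition algorithm : Type :=
  forall n, linorder 'I_n -> allocation 'I_n 'I_n -> program 'I_n 'I_n.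

Definition solves_CheckPO (A : algorithm) : Prop :=
  forall n (axis : linorder 'I_n) (L : profile 'I_n 'I_n)
    (pi0 : allocation 'I_n 'I_n),
  single_peaked axis L ->
  run (A n axis pi0) L = true <-> pareto_optimal L pi0.

Definition query_durations : Type :=
  forall n, query 'I_n 'I_n -> linorder 'I_n -> nat.

Definition worst_case_time (d : query_durations) (A : algorithm) (n : nat)
    : nat :=
  \max_(axis : linorder 'I_n) \max_(pi0 : allocation 'I_n 'I_n)
    \max_(L : profile 'I_n 'I_n | single_peaked axis L)
      time (d n) (A n axis pi0) L.

(* Main.v *)
(* Take the axis 0 < 1 < ... < n-1 and the identity allocation.  When every
   agent ranks the resources in the order 0, 1, ..., n-1, this allocation is
   Pareto-optimal.  If an algorithm halts on this profile without having
   queried some agent k < n-1, it answers the same when k's order is reversed;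
   but then k and k+1 both gain by exchanging their resources.  Hence n-1
   agents have to be queried. *)
Require Import Defs.
From mathcomp Require Import all_boot all_order all_algebra perm zify.

Set Implicit Arguments.
Unset Strict Implicit.

Section Queried.
Local Open Scope nat_scope.
Variables N R : finType.
Implicit Types (p : program N R) (L : profile N R).

(** Only the branch selected by the answers of [L] counts, not the whole tree. *)
Fixpoint queried p L : {set N} :=
  match p with
  | Return _ => set0
  | Compute p' => queried p' L
  | Ask q k => addressee q |: queried (k (reply q (L (addressee q)))) L
  end.

(** Each query meets the same order in both profiles, so both runs follow the same branch. *)
Lemma eq_run p L L' : {in queried p L, L =1 L'} -> run p L = run p L'.
Proof.
elim: p => [b|p IHp|q k IHk] //= eqL.
have <- : L (addressee q) = L' (addressee q) by apply: eqL; rewrite setU11.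
by apply: IHk => a a_q; apply: eqL; rewrite setU1r.
Qed.

(** Each query adds at most one new agent to the set and costs at least one unit. *)
Lemma card_queried_le_time (d : query N R -> linorder R -> nat) p L :
  (forall q o, 0 < d q o) -> #|queried p L| <= time d p L.
Proof.
move=> d_gt0; elim: p => [b|p IHp|q k IHk] /=; first by rewrite cards0.
  exact: leqW.
by rewrite cardsU1 leq_add// (leq_trans (leq_b1 _)).
Qed.

End Queried.

Section HardProfile.
Local Open Scope nat_scope.
Variable n : nat.

Fact ltn_strict_linear :
  strict_linear [ffun x : 'I_n => [ffun y : 'I_n => x < y]].
Proof.
apply/and3P; split.
- by apply/forallP => x; rewrite !ffunE ltnn.
- apply/'forall_'forall_forallP => x y z; rewrite !ffunE.
  by apply/implyP => /andP[]; apply: ltn_trans.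
- by apply/'forall_forallP => x y; rewrite !ffunE neq_ltn implybb.
Qed.

Fact gtn_strict_linear :
  strict_linear [ffun x : 'I_n => [ffun y : 'I_n => y < x]].
Proof.
apply/and3P; split.
- by apply/forallP => x; rewrite !ffunE ltnn.
- apply/'forall_'forall_forallP => x y z; rewrite !ffunE.
  by apply/implyP => /andP[xy yz]; apply: ltn_trans xy.
- by apply/'forall_forallP => x y; rewrite !ffunE neq_ltn orbC implybb.
Qed.

Definition ltn_order := LinOrder ltn_strict_linear.
Definition gtn_order := LinOrder gtn_strict_linear.

Lemma ltn_orderE x y : ltn_order x y = (x < y).
Proof. by rewrite !ffunE. Qed.

Lemma gtn_orderE x y : gtn_order x y = (y < x).
Proof. by rewrite !ffunE. Qed.

(** The top is the left end of the axis, so the case of resources to its left is void. *)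
Lemma ltn_order_single_peaked : single_peaked_order ltn_order ltn_order.
Proof.
apply/forallP => t; apply/implyP => /forallP t_top.
apply/'forall_forallP => r r'; rewrite !ltn_orderE.
have := t_top r; rewrite ltn_orderE -val_eqE /=; lia.
Qed.

Lemma gtn_order_single_peaked : single_peaked_order ltn_order gtn_order.
Proof.
apply/forallP => t; apply/implyP => /forallP t_top.
apply/'forall_forallP => r r'; rewrite !ltn_orderE gtn_orderE.
have := t_top r; rewrite gtn_orderE -val_eqE /=; lia.
Qed.

Fact perm_allocation_subproof (s : 'S_n) : injectiveb [ffun x => s x].
Proof. by apply/injectiveP => x y; rewrite !ffunE => /perm_inj. Qed.

Definition perm_allocation (s : 'S_n) := Allocation (perm_allocation_subproof s).

Lemma perm_allocationE s x : perm_allocation s x = s x.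
Proof. by rewrite ffunE. Qed.

Definition common_profile : profile 'I_n 'I_n := [ffun=> ltn_order].

Definition reversed_at (k : 'I_n) : profile 'I_n 'I_n :=
  [ffun a => if a == k then gtn_order else ltn_order].

Lemma common_profile_single_peaked : single_peaked ltn_order common_profile.
Proof. by apply/forallP => a; rewrite ffunE ltn_order_single_peaked. Qed.

Lemma reversed_at_single_peaked k : single_peaked ltn_order (reversed_at k).
Proof.
apply/forallP => a; rewrite ffunE.
by case: ifP; rewrite ?ltn_order_single_peaked ?gtn_order_single_peaked.
Qed.

(* A Pareto improvement would permute the resources while decreasing the sum of
   their indices. *)
Lemma pareto_optimal_common pi : pareto_optimal common_profile pi.
Proof.
case=> pi' [improves [a]]; rewrite ffunE ltn_orderE => lt_a.
(* An injective map of ['I_n] into itself only reorders the sum of all indices. *)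
have sumE (f : allocation 'I_n 'I_n) : \sum_b (f b : nat) = \sum_(b < n) b.
  by rewrite [RHS](reindex_inj (injectiveP _ (valP f))).
have le_pi b : pi' b <= pi b ?= iff (pi' b == pi b :> nat).
  split=> //; case: (improves b) => [|-> //].
  by rewrite ffunE ltn_orderE => /ltnW.
(* Termwise comparison with equal sums forces equality at every agent, against the strict gain of
   [a]. *)
have [_] := leqif_sum (fun b (_ : true) => le_pi b).
by rewrite !sumE eqxx => /esym/forallP/(_ a)/=; rewrite ltn_eqF.
Qed.

Lemma not_pareto_optimal_reversed_at (k : 'I_n) :
  k.+1 < n -> ~ pareto_optimal (reversed_at k) (perm_allocation 1).
Proof.
move=> lt_k; apply; pose k1 := Ordinal lt_k.
exists (perm_allocation (tperm k k1)); split=> [a|].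
  rewrite !perm_allocationE perm1 ffunE; case: tpermP => [->|->|]; last by right.
    by left; rewrite eqxx gtn_orderE /=.
  by left; rewrite -val_eqE /= gtn_eqF// ltn_orderE /=.
by exists k; rewrite !perm_allocationE perm1 tpermL ffunE eqxx gtn_orderE /=.
Qed.

End HardProfile.

Lemma pred_le_worst_case_time (d : query_durations) (A : algorithm) (n : nat) :
    (forall q o, 0 < d n q o)%N -> solves_CheckPO A ->
  (n.-1 <= worst_case_time d A n)%N.
Proof.
case: n => // n d_gt0 A_correct /=.
pose p := A n.+1 (ltn_order n.+1) (perm_allocation 1).
(* The last agent is left out: it has no successor to exchange with. *)
have all_queried : ~: [set ord_max] \subset queried p (common_profile n.+1).
  apply/subsetP => k; rewrite !inE => k_max; apply/negPn/negP => k_notin.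
  have lt_k : (k.+1 < n.+1)%N.
    by move: k_max; rewrite -val_eqE /= ltnS ltn_neqAle -ltnS ltn_ord andbT.
  apply: (not_pareto_optimal_reversed_at lt_k).
  (* Correctness is used twice: the answer yes on the common profile would carry over to the
     reversed one. *)
  apply/(A_correct _ _ _ _ (reversed_at_single_peaked k)).
  rewrite -(@eq_run _ _ _ (common_profile n.+1)).
    apply/(A_correct _ _ _ _ (common_profile_single_peaked n.+1)).
    exact: pareto_optimal_common.
  move=> a a_in; rewrite !ffunE; case: eqP => // a_k.
  by rewrite -a_k a_in in k_notin.
rewrite -[n in leqLHS]/n.+1.-1 -[n.+1 in leqLHS]card_ord.
rewrite -(cardsC1 (ord_max : 'I_n.+1)).
apply: leq_trans (subset_leq_card all_queried) _.
apply: leq_trans (card_queried_le_time _ _ d_gt0) _.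
(* The hard instance is one of those over which the three nested maxima range. *)
apply: leq_trans (leq_bigmax (ltn_order n.+1)).
apply: leq_trans (leq_bigmax (perm_allocation 1)).
exact: leq_bigmax_cond (common_profile_single_peaked n.+1).
Qed.

(* Imported only here because classical_sets shadows the names of finset. *)
From mathcomp Require Import all_classical all_reals all_analysis.
Import GRing.Theory Num.Theory numFieldNormedType.Exports.
Local Open Scope classical_set_scope.
Local Open Scope ring_scope.

Theorem proposition4 (R : realType) (d : query_durations)
    (d_gt0 : forall (n : nat) (q : query 'I_n 'I_n) (o : linorder 'I_n),
      (0 < d n q o)%N)
    (A : algorithm) (A_correct : solves_CheckPO A) :
  (fun n : nat => (worst_case_time d A n)%:R : R)
    \is 'Omega_\oo (fun n : nat => n%:R : R).
Proof.
(* The constant 1/2 absorbs the missing agent: n - 1 is at least n/2 once n is at least 2. *)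
rewrite qualifE; apply/asboolP; exists 2^-1; first by rewrite invr_gt0 ltr0n.
near=> n; rewrite !normr_nat ler_pdivrMl ?ltr0n// -natrM ler_nat.
have n_gt1 : (1 < n)%N by near: n; exact: nbhs_infty_gt.
have := pred_le_worst_case_time (d_gt0 n) A_correct; lia.
Unshelve. all: by end_near. Qed.
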